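(* Let $X$ be a $\mathfrak{b}$-Sierpiński set. Then $B(X)$ is sequentially separable, but is not strongly sequentially separable.
   Context: $\mathfrak{b}$ is the minimal cardinality of a $\leq^*$-unbounded subset of $\omega^\omega$, where $f\le^* g$ means $f(n)\le g(n)$ for all but finitely many $n$. For an uncountable cardinal $\kappa$, a $\kappa$-Sierpiński set is a set of real numbers of cardinality at least $\kappa$ whose intersection with each set of Lebesgue measure zero has cardinality less than $\kappa$. $B_0(X)=C(X)$ is the set of continuous real-valued functions on $X$; for each ordinal $0<\alpha\le\omega_1$, $B_\alpha(X)$ is the set of pointwise limits of sequences from $\bigcup_{\xi<\alpha}B_\xi(X)$; $B(X)=B_{\omega_1}(X)$ is the space of all Baire (Borel, as $X$ is metrizable) functions, with the topology of pointwise convergence. A subset $D$ of a space $Z$ is sequentially dense if every point of $Z$ is the limit of a sequence of points of $D$. $Z$ is sequentially separable if it has a countable sequentially dense subset; it is strongly sequentially separable if it is separable and every countable dense subset of $Z$ is sequentially dense. *)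

(* Defs.v *)
From HB Require Import structures.
From mathcomp Require Import all_boot all_order all_algebra.
From mathcomp Require Import all_classical all_reals all_analysis.
From mathcomp Require wochoice.
Import Order.TTheory GRing.Theory Num.Theory.
Import numFieldNormedType.Exports.

Set Implicit Arguments.
Unset Strict Implicit.
Unset Printing Implicit Defensive.

Local Open Scope classical_set_scope.
Local Open Scope card_scope.

(* Any nonempty family of sets has a member of least cardinality.  The library
   has no type of cardinals, so a cardinal is represented by a set of that
   cardinality. *)
Lemma exists_min_card (T : Type) (P : set (set T)) : P !=set0 ->
  exists A, P A /\ forall B, P B -> A #<= B.
Proof.
move=> [A0 PA0].
have [B0|allN0] := pselect (exists2 B, P B & B = set0).
  by case: B0 => B PB B0; exists B; split => // C PC; rewrite B0 card_ge0.
have [a0 _] : A0 !=set0.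
  by apply/set0P/eqP => E; apply: allN0; exists A0.
pose Q (S : set (set T -> T)) :=
  (forall g, S g -> forall B, P B -> B (g B)) /\
  (forall g h, S g -> S h -> forall B, P B -> g B = h B -> g = h).
have [S [[QS1 QS2] maxS]] : exists S, Q S /\ forall S', S `<` S' -> ~ Q S'.
  apply: Zorn_bigcup => F FQ Ftot; split.
    by move=> g [S FS Sg]; apply: (FQ _ FS).1.
  move=> g h [S FS Sg] [S' FS' S'h].
  case: (Ftot _ _ FS FS') => sub.
    by apply: (FQ _ FS').2 => //; apply: sub.
  by apply: (FQ _ FS).2 => //; apply: sub.
(* some projection of S is onto *)
have [[A PA Asurj]|nosurj] :=
    pselect (exists2 A, P A & forall a, A a -> exists2 g, S g & g A = a).
  exists A; split => // B PB.
  have AS : A #<= S.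
    apply: (card_le_trans (B := (fun g : set T -> T => g A) @` S)).
      by apply: subset_card_le => a /Asurj [g Sg <-]; exists g.
    exact: card_image_le.
  apply: (card_le_trans AS).
  apply: (card_le_trans (B := (fun g : set T -> T => g B) @` S)).
    have inj : {in S &, injective (fun g : set T -> T => g B)}.
      by move=> g h /set_mem Sg /set_mem Sh; apply: QS2.
    by have := inj_card_eq inj; rewrite card_eq_sym => /card_eqPle [].
  by apply: subset_card_le => _ [g Sg <-]; exact: (QS1 _ Sg _ PB).
exfalso.
have miss B : exists b, P B -> B b /\ forall g, S g -> g B <> b.
  have [PB|nPB] := pselect (P B); last by exists a0.
  have /existsNP [b /not_implyP [Bb nb]] :
      ~ forall b, B b -> exists2 g, S g & g B = b.
    by move=> H; apply: nosurj; exists B.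
  by exists b => _; split => // g Sg gB; apply: nb; exists g.
have [h hP] := choice miss.
apply: (maxS (S `|` [set h])).
  split; first by left.
  move=> /(_ h (or_intror erefl)) Sh.
  by have [_ /(_ _ Sh)] := hP _ PA0.
split.
  by move=> g [Sg|->] B PB; [exact: (QS1 _ Sg _ PB)|have [] := hP _ PB].
move=> g k [Sg|->] [Sk|->] B PB; first exact: QS2.
- by move=> E; have [_ /(_ _ Sg)] := hP _ PB.
- by move=> /esym E; have [_ /(_ _ Sk)] := hP _ PB.
- by [].
Qed.

(* f <=* g *)
Definition le_star (f g : nat -> nat) := \forall n \near \oo, (f n <= g n)%N.

Definition le_star_unbounded (F : set (nat -> nat)) :=
  ~ exists g, forall f, F f -> le_star f g.

Lemma le_star_unboundedT : le_star_unbounded [set: nat -> nat].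
Proof.
move=> [g gP]; have [N _ NP] := gP (fun n => (g n).+1) I.
by have := NP N (leqnn N); rewrite /= ltnn.
Qed.

Lemma exists_bounding_number : exists F, le_star_unbounded F /\
  forall G, le_star_unbounded G -> F #<= G.
Proof. by apply: exists_min_card; exists setT; exact: le_star_unboundedT. Qed.

(* The cardinal b, represented by an unbounded set of least cardinality; only
   its cardinality is meaningful. *)
Definition bounding_number : set (nat -> nat) := sval (cid exists_bounding_number).

Lemma bounding_numberP : le_star_unbounded bounding_number /\
  forall G, le_star_unbounded G -> bounding_number #<= G.
Proof. exact: svalP (cid exists_bounding_number). Qed.

Lemma bounding_number_uncountable : ~ countable bounding_number.
Proof.
move=> /countable_injP [e einj]; case: bounding_numberP => unb _; apply: unb.
pose d k : nat -> nat :=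
  if pselect (exists2 f, bounding_number f & e f = k) is left H
  then s2val (cid2 H) else fun=> 0%N.
exists (fun n => \sum_(k < n.+1) d k n)%N => f bf.
exists (e f) => // n /= len.
have -> : f = d (e f).
  rewrite /d; case: pselect => [H|nH]; last by exfalso; apply: nH; exists f.
  case: (cid2 H) => g bg /= eg.
  by apply: einj; rewrite ?inE.
by rewrite (bigD1 (Ordinal (len : e f < n.+1)%N)) //= leq_addr.
Qed.

(* kappa-Sierpinski sets of reals, kappa being the cardinality of K. *)
Definition sierpinski_set (T : Type) (K : set T) (R : realType) (X : set R) :=
  K #<= X /\
  forall N : set R, (@lebesgue_measure R).-negligible N ->
    X `&` N #<= K /\ ~ (K #<= X `&` N).

(* A well-order of the power set of nat, from the well-ordering principle; the
   points with countably many predecessors form a copy of omega_1. *)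
Definition wo_le : rel (set nat) :=
  sval (wochoice.well_ordering_principle (set nat : eqType)).

Definition wo_lt (A B : set nat) : Prop := wo_le A B /\ A <> B.

Definition omega1 : set (set nat) := [set A | countable [set B | wo_lt B A]].

Definition omega1_lt (a b : omega1) : Prop := wo_lt (set_val a) (set_val b).

Lemma wo_min (P : set (set nat)) : P !=set0 ->
  exists A, P A /\ forall B, P B -> wo_le A B.
Proof.
move=> [A PA].
have := svalP (wochoice.well_ordering_principle (set nat : eqType)).
move=> /(_ (fun A => `[< P A >])) [].
  by exists A; rewrite unfold_in; apply/asboolP.
move=> B [[PB minB] _]; exists B; split; first exact/asboolP.
by move=> C PC; apply: minB; rewrite unfold_in; apply/asboolP.
Qed.

Lemma wo_le_min2 A B : exists C, [/\ C = A \/ C = B, wo_le C A & wo_le C B].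
Proof.
have [|C [CAB Cmin]] := @wo_min [set C | C = A \/ C = B]; first by exists A; left.
by exists C; split => //; apply: Cmin; [left|right].
Qed.

Lemma wo_le_total A B : wo_le A B \/ wo_le B A.
Proof. by have [C [[->|->] ? ?]] := wo_le_min2 A B; [left|right]. Qed.

Lemma wo_le_anti A B : wo_le A B -> wo_le B A -> A = B.
Proof.
move=> AB BA; have := svalP (wochoice.well_ordering_principle (set nat : eqType)).
move=> /(_ (fun C => `[< C = A \/ C = B >])) [].
  by exists A; rewrite unfold_in; apply/asboolP; left.
have refl C : wo_le C C by case: (wo_le_total C C).
move=> C [_ Cuniq]; transitivity C; [symmetry|]; apply: Cuniq; split.
- by rewrite unfold_in; apply/asboolP; left.
- by move=> D; rewrite unfold_in => /asboolP[->|->].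
- by rewrite unfold_in; apply/asboolP; right.
- by move=> D; rewrite unfold_in => /asboolP[->|->].
Qed.

Lemma wo_lt_trans A B C : wo_lt A B -> wo_lt B C -> wo_lt A C.
Proof.
move=> [AB nAB] [BC nBC].
have [|D [DP Dmin]] := @wo_min [set D | [\/ D = A, D = B | D = C]].
  by exists A; constructor 1.
have DA : wo_le D A by apply: Dmin; constructor 1.
have DB : wo_le D B by apply: Dmin; constructor 2.
have DC : wo_le D C by apply: Dmin; constructor 3.
case: DP => E; rewrite {}E in DA DB DC.
- by split => // E; apply: nBC; apply: wo_le_anti => //; rewrite -E.
- by exfalso; apply: nAB; apply: wo_le_anti.
- by exfalso; apply: nBC; apply: wo_le_anti.
Qed.

Lemma wo_ltN A B : ~ wo_lt A B -> wo_le B A.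
Proof.
move=> nAB; have [AB|//] := wo_le_total A B.
have [E|nE] := pselect (A = B); first by move: AB; rewrite E.
by exfalso; apply: nAB.
Qed.

Lemma wo_lt_le A B : wo_lt A B -> ~ wo_le B A.
Proof. by move=> [AB nAB] BA; apply: nAB; exact: wo_le_anti. Qed.

Lemma omega1_lt_trans a b c : omega1_lt a b -> omega1_lt b c -> omega1_lt a c.
Proof. exact: wo_lt_trans. Qed.

Lemma omega1_lt_total a b : [\/ omega1_lt a b, a = b | omega1_lt b a].
Proof.
have [->|nab] := pselect (a = b); first by constructor 2.
have {}nab : set_val a <> set_val b by move=> /val_inj.
have [ab|ba] := wo_le_total (set_val a) (set_val b); first by constructor 1.
by constructor 3; split => // E; apply: nab.
Qed.

Lemma omega1_lt_wf : well_founded omega1_lt.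
Proof.
move=> a; apply: contrapT => nacc.
have [|A [[b -> nb] bmin]] := @wo_min [set A | exists2 c : omega1,
    A = set_val c & ~ Acc omega1_lt c]; first by exists (set_val a); exists a.
apply: nb; constructor => c cb; apply: contrapT => nc.
by apply: (wo_lt_le cb); apply: bmin; exists c.
Qed.

Lemma omega1_lt_countable a : countable [set b | omega1_lt b a].
Proof.
apply: (@sub_countable _ _ _ [set B | wo_lt B (set_val a)]); last first.
  exact: set_valP a.
have inj : {in [set b | omega1_lt b a] &, injective (@set_val _ omega1)}.
  by move=> b c _ _ /val_inj.
have := inj_card_eq inj; rewrite card_eq_sym => /card_eqPle [le _].
by apply: (card_le_trans le); apply: subset_card_le => _ [b ba <-].
Qed.

Lemma omega1_uncountable : ~ countable omega1.
Proof.
move=> cW.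
have [|A [nWA Amin]] := @wo_min (~` omega1).
  apply: contrapT => /nonemptyPn W0.
  have : countable [set: set nat].
    apply: sub_countable cW; apply: subset_card_le => A _.
    by apply: contrapT => nA; have : (~` omega1) A by []; rewrite W0.
  move=> /countable_injP [e einj].
  pose D : set nat := [set n | exists2 A : set nat, e A = n & ~ A n].
  have nD : ~ D (e D).
    move=> DD; move: (DD) => [A /einj E nA]; apply: nA.
    by rewrite E ?inE.
  by apply: (nD); exists D.
apply: nWA; apply: sub_countable cW; apply: subset_card_le => B BA.
by apply: contrapT => nB; apply: (wo_lt_le BA); exact: Amin.
Qed.

(* The ordinals alpha <= omega_1: Some a is a countable ordinal and None is
   omega_1. *)
Definition ord_lt (a b : option omega1) : Prop :=
  match a, b with
  | Some a, Some b => omega1_lt a b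
  | Some _, None => True
  | None, _ => False
  end.

Lemma ord_lt_wf : well_founded ord_lt.
Proof.
have accS (a : omega1) : Acc ord_lt (Some a).
  elim/(well_founded_ind omega1_lt_wf): a => a IH.
  by constructor => -[b /IH|//].
by move=> [a|]; [exact: accS|constructor => -[b _|//]; exact: accS].
Qed.

Section Baire.
Context {R : realType} (X : topologicalType).

(* Each B_alpha; in the second case alpha > 0 since beta 0 < alpha. *)
Inductive baire_class : option omega1 -> set (X -> R) :=
| Baire0 alpha (f : X -> R) :
    (forall beta, ~ ord_lt beta alpha) -> continuous f -> baire_class alpha f
| BaireLim alpha (f : X -> R) (beta : nat -> option omega1) (u : nat -> X -> R) :
    (forall n, ord_lt (beta n) alpha) -> (forall n, baire_class (beta n) (u n)) ->
    (forall x, (fun n => u n x) @ \oo --> f x) -> baire_class alpha f.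

Lemma baire_class0 alpha : (forall beta, ~ ord_lt beta alpha) ->
  baire_class alpha = [set f | continuous f].
Proof.
move=> a0; apply/seteqP; split => f; last exact: Baire0.
by move=> Bf; case: Bf a0 => [//|? ? beta u lt _ _ /(_ _ (lt 0%N))].
Qed.

Lemma baire_classE alpha : (exists beta, ord_lt beta alpha) ->
  baire_class alpha = [set f | exists u : nat -> X -> R,
    (forall n, (\bigcup_(beta in [set beta | ord_lt beta alpha])
                   baire_class beta) (u n)) /\
    forall x, (fun n => u n x) @ \oo --> f x].
Proof.
move=> a0; apply/seteqP; split => f.
  move=> Bf; case: Bf a0 => [? ? H _ [b /H]//|? {}f beta u lt Bu uf _].
  by exists u; split => // n; exists (beta n); [exact: lt|exact: Bu].
move=> [u [Bu uf]].
have /choice [beta betaP] :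
    forall n, exists beta, ord_lt beta alpha /\ baire_class beta (u n).
  by move=> n; have [b ltb Bb] := Bu n; exists b.
by apply: (@BaireLim alpha f beta u) => // n; case: (betaP n).
Qed.

(* B(X), with the topology induced by that of pointwise convergence. *)
Definition baire_functions : topologicalType :=
  set_type (baire_class None : set {ptws X -> R}).

End Baire.
Arguments baire_functions : clear implicits.

Section SequentialSeparability.
Variable Z : topologicalType.

Definition sequentially_dense (D : set Z) :=
  forall z : Z, exists u : nat -> Z, (forall n, D (u n)) /\ u @ \oo --> z.

Definition separable_space := exists D : set Z, countable D /\ dense D.

Definition sequentially_separable :=
  exists D : set Z, countable D /\ sequentially_dense D.

Definition strongly_sequentially_separable :=
  separable_space /\
  forall D : set Z, countable D -> dense D -> sequentially_dense D.

End SequentialSeparability.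

(* Main.v *)
Require Import Defs.
From HB Require Import structures.
From mathcomp Require Import all_boot all_order all_algebra.
From mathcomp Require Import all_classical all_reals all_analysis.
From mathcomp Require Import ring lra.
Import Order.TTheory GRing.Theory Num.Theory.
Import numFieldNormedType.Exports.
Set Implicit Arguments.
Unset Strict Implicit.
Unset Printing Implicit Defensive.
Local Open Scope classical_set_scope.
Local Open Scope ring_scope.

(** Write D for the countable family of finite rational combinations of
    rational ramps; these piecewise linear functions are continuous on the
    whole line, and their restrictions to X are Baire functions.

    Sequential separability.  A set X as in the theorem bounds Borel families
    of functions from nat to nat: if the measurable sets A n m increase with m
    and cover X for every n, then a single g satisfies x \in A n (g n) for
    almost all n, for every x in X ([sierpinski_eventually]).  Indeed, by
    Borel-Cantelli, some g works off a null set N; as X meets N in fewer than b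
    points, the functions sending n to the first m with x \in A n m, for x in
    both X and N, are dominated by one function, and the maximum of the two
    works everywhere.  Applied to sets on which a sequence from D is within
    1/(n+1) of its limit, this makes diagonal sequences converge: the pointwise
    limits on X of sequences from D are closed under pointwise limits of
    sequences ([pl_limit_closed]).  They include the continuous functions, by
    interpolation ([continuous_lim_pl]), hence all Baire functions, by
    induction on the Baire class.

    Failure of the strong form.  Fix e > 0 and keep only the members s of D for
    which the set where |s| <= 1/2 has measure at most e.  They are still dense
    in B(X): prescribe values at finitely many points, using thin bumps, and
    leave the function equal to 1 elsewhere ([pl_dense]).  If a sequence of
    them converged to 0 on X, every point of X would lie in almost all of these
    sets; their lower limit is an increasing union of sets of measure at most
    e, so it has measure at most e ([measure_liminf_le]).  As e is arbitrary, X
    would be null, and then X would have fewer than b points. *)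

(** * Bounding along a Sierpinski set *)

(** If no such g existed, the functions [h x] would form an unbounded family of
    size at most that of Y, and b would be at most the size of Y. *)
Lemma le_star_dominated (T : Type) (Y : set T) (h : T -> nat -> nat) :
  ~ (bounding_number #<= Y)%card ->
  exists g, forall x, Y x -> le_star (h x) g.
Proof.
move=> small; apply: contrapT => unb; apply: small.
apply: (card_le_trans (B := h @` Y)); last exact: card_image_le.
apply: bounding_numberP.2 => -[g gP]; apply: unb; exists g => x Yx.
by apply: gP; exists x.
Qed.

Section measure.
Context {R : realType}.
Notation mu := (@lebesgue_measure R).

Lemma lebesgue_measure_le (A B : set R) :
  measurable A -> measurable B -> A `<=` B -> (mu A <= mu B)%E.
Proof. by move=> mA mB AB; apply: le_measure; rewrite ?inE. Qed.

(** On the bounded window [-n, n] the measure of the points not yet reached by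
    [A n m] tends to 0 with m, so [g n] can be chosen to make it less than
    2^-(n+1); by Borel-Cantelli almost every point is in finitely many of
    these exceptional sets, and it belongs to almost all windows. *)
Lemma almost_everywhere_eventually (A : nat -> nat -> set R) (Y : set R) :
  (forall n m, measurable (A n m)) ->
  (forall n, {homo A n : m p / (m <= p)%N >-> m `<=` p}) ->
  (forall n, Y `<=` \bigcup_m A n m) ->
  exists g (N : set R), mu.-negligible N /\
    forall x, Y x -> ~ N x -> \forall n \near \oo, A n (g n) x.
Proof.
move=> mA incA YA.
pose E n m : set R := `[- n%:R, n%:R]%classic `&` (\bigcup_p A n p) `\` A n m.
have mE n m : measurable (E n m).
  apply: measurableD => //; apply: measurableI => //.
  exact: bigcup_measurable.
have /choice [g gP] : forall n, exists m, (mu (E n m) < (1 / (2 ^ n.+1)%:R)%:E)%E.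
  move=> n.
  have E0 : \bigcap_m E n m = set0.
    rewrite -subset0 => x /= xE; have [[_ [m _ Anm]] _] := xE 0%N I.
    by have [_] := xE m I; apply.
  have : mu \o E n @ \oo --> mu (\bigcap_m E n m).
    apply: nonincreasing_cvg_mu => //.
    - apply: (le_lt_trans (y := mu `[- n%:R, n%:R]%classic)).
        by apply: lebesgue_measure_le => // x [[]].
      by rewrite lebesgue_measure_itv /=; case: ifP => // _; rewrite ltry.
    - by move=> m; exact: mE.
    - by rewrite E0; exact: measurable0.
    - move=> m p mp; apply/subsetPset => x [xn nA]; split => // Am; apply: nA.
      exact: incA Am.
  rewrite E0 measure0 => /(_ [set y | (y < (1 / (2 ^ n.+1)%:R)%:E)%E]) [].
    apply: open_nbhs_nbhs; split; first exact: open_ereal_lt_ereal.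
    by rewrite /= lte_fin divr_gt0 // ltr0n expn_gt0.
  by move=> m _ /(_ m (leqnn m)) /= ?; exists m.
exists g, (lim_sup_set (fun n => E n (g n))); split.
  exists (lim_sup_set (fun n => E n (g n))); split => //.
    apply: bigcap_measurableType => n _; apply: bigcup_measurable => k _.
    exact: mE.
  apply: lim_sup_set_cvg0; first by move=> n; exact: mE.
  apply: (le_lt_trans (y := 1%:E)); last exact: ltry.
  apply: le_trans (@epsilon_trick0 R 1 xpredT _) => //.
  apply: lee_nneseries => n *; [exact: measure_ge0|exact/ltW/gP].
move=> x Yx nN.
have [n nE] : exists n, forall j, (n <= j)%N -> ~ E j (g j) x.
  apply: contrapT => H; apply: nN => n _; apply: contrapT => nE; apply: H.
  by exists n => j nj Ej; apply: nE; exists j.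
near=> j; apply: contrapT => nA; apply: (nE j); first by near: j; exact: nbhs_infty_ge.
split => //; split; last exact: YA.
rewrite /= in_itv /= -ler_norml; near: j; exact: nbhs_infty_ger.
Unshelve. all: by end_near. Qed.

(** The null set left over by [almost_everywhere_eventually] meets X in fewer
    than b points, for which a dominating function exists. *)
Lemma sierpinski_eventually (X : set R) (A : nat -> nat -> set R) :
  sierpinski_set bounding_number X ->
  (forall n m, measurable (A n m)) ->
  (forall n, {homo A n : m p / (m <= p)%N >-> m `<=` p}) ->
  (forall n, X `<=` \bigcup_m A n m) ->
  exists g, forall x, X x -> \forall n \near \oo, A n (g n) x.
Proof.
move=> [_ smallX] mA incA XA.
have [g [N [N0 gP]]] := almost_everywhere_eventually mA incA XA.
have /choice [h hP] : forall x, exists h : nat -> nat, X x -> forall n, A n (h n) x.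
  move=> x; have [Xx|nX] := pselect (X x); last by exists (fun=> 0%N).
  have /choice [h hP] : forall n, exists m, A n m x.
    by move=> n; have [m _ ?] := XA n _ Xx; exists m.
  by exists h.
have [k kP] := le_star_dominated h (smallX _ N0).2.
exists (fun n => maxn (g n) (k n)) => x Xx.
have [Nx|nN] := pselect (N x).
  near=> n; apply: (incA n (h x n)); last exact: hP.
  by rewrite leq_max; apply/orP; right; near: n; exact: kP.
near=> n; apply: (incA n (g n)); first exact: leq_maxl.
by near: n; exact: gP.
Unshelve. all: by end_near. Qed.

(** * Measure estimates *)

Lemma sierpinski_not_negligible (X : set R) :
  sierpinski_set bounding_number X -> ~ mu.-negligible X.
Proof. by move=> [bX smallX] /smallX [_]; rewrite setIid. Qed.

Lemma negligible_of_small_covers (X : set R) :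
  (forall e : R, 0 < e ->
    exists B, [/\ measurable B, X `<=` B & (mu B <= e%:E)%E]) ->
  mu.-negligible X.
Proof.
move=> cov.
have /choice [B BP] : forall n : nat, exists B,
    [/\ measurable B, X `<=` B & (mu B <= (n.+1%:R^-1)%:E)%E].
  by move=> n; apply: cov; rewrite invr_gt0.
have mB : measurable (\bigcap_n B n).
  by apply: bigcap_measurableType => // n _; case: (BP n).
exists (\bigcap_n B n); split => //; last first.
  by move=> x Xx n _; case: (BP n) => _ XB _; exact: XB.
apply/eqP; rewrite eq_le measure_ge0 andbT.
apply/lee_addgt0Pr => e e0; rewrite add0e.
have [n _ ne] := @nbhs_infty_gtr R e^-1.
have [mBn _ muB] := BP n.
apply: (@le_trans _ _ (mu (B n))).
  by apply: lebesgue_measure_le => // x; apply.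
apply: (le_trans muB); rewrite lee_fin invf_ple ?posrE // ltW //.
apply: lt_trans (ne n (leqnn n)) _; by rewrite ltr_nat.
Qed.

(** Continuity from below: the lower limit is the increasing union of the
    intersections of tails, each of measure at most [e]. *)
Lemma measure_liminf_le (O : nat -> set R) (e : \bar R) :
  (forall n, measurable (O n)) -> (forall n, (mu (O n) <= e)%E) ->
  let L := \bigcup_n \bigcap_(i in [set i | (n <= i)%N]) O i in
  measurable L /\ (mu L <= e)%E.
Proof.
move=> mO Oe L.
pose F n := \bigcap_(i in [set i | (n <= i)%N]) O i.
have mF n : measurable (F n) by apply: bigcap_measurableType.
have mL : measurable L by apply: bigcup_measurable => n _; exact: mF.
split => //.
have cv : mu \o F @ \oo --> mu L.
  apply: nondecreasing_cvg_mu => //.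
  move=> n m nm; apply/subsetPset => x xF i /= mi.
  by apply: xF => /=; exact: leq_trans mi.
apply: (cvge_to_le cv).
near=> n; apply: le_trans (Oe n); apply: lebesgue_measure_le => //.
by move=> x; apply => /=.
Unshelve. all: by end_near. Qed.

End measure.

(** * Rational piecewise linear functions *)

Section piecewise_linear.
Context {R : realType}.
Notation mu := (@lebesgue_measure R).

(** The clamping of y to [0, 1], written with absolute values so that its
    continuity is immediate. *)
Definition ramp (y : R) : R := (`|y| - `|y - 1| + 1) / 2.

Lemma ramp_le0 y : y <= 0 -> ramp y = 0.
Proof.
by move=> y0; rewrite /ramp ler0_norm // ler0_norm; [field|lra].
Qed.

Lemma ramp_ge1 y : 1 <= y -> ramp y = 1.
Proof.
by move=> y1; rewrite /ramp ger0_norm ?ger0_norm; [field|lra|lra].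
Qed.

Lemma ramp_itv y : 0 <= y <= 1 -> ramp y = y.
Proof.
by move=> /andP[y0 y1]; rewrite /ramp ger0_norm // ler0_norm; [field|lra].
Qed.

Lemma continuous_ramp : continuous ramp.
Proof.
move=> y; apply: cvgM; last exact: cvg_cst.
apply: cvgD; last exact: cvg_cst.
apply: cvgB; first by apply: cvg_norm; exact: cvg_id.
by apply: cvg_norm; apply: cvgB; [exact: cvg_id|exact: cvg_cst].
Qed.

(** A triple (c, m, a) encodes the term z |-> c * ramp (m z - a); such codes form
    a countable type. *)
Definition pl (s : seq (rat * rat * rat)) (z : R) : R :=
  \sum_(t <- s) ratr t.1.1 * ramp (ratr t.1.2 * z - ratr t.2).

Lemma pl_cons c m a s z :
  pl ((c, m, a) :: s) z = ratr c * ramp (ratr m * z - ratr a) + pl s z.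
Proof. by rewrite /pl big_cons. Qed.

Lemma continuous_pl s : continuous (pl s).
Proof.
elim: s => [|[[c m] a] s IH] z.
  have -> : pl [::] = cst 0 by apply/funext => y; rewrite /pl big_nil.
  exact: cvg_cst.
have -> : pl ((c, m, a) :: s) =
    (fun z => ratr c * ramp (ratr m * z - ratr a) + pl s z).
  by apply/funext => y; exact: pl_cons.
apply: cvgD; last exact: IH.
apply: cvgM; first exact: cvg_cst.
apply: (@cvg_comp _ _ _ (fun z => ratr m * z - ratr a) ramp); last first.
  exact: continuous_ramp.
by apply: cvgB; [apply: cvgM; [exact: cvg_cst|exact: cvg_id]|exact: cvg_cst].
Qed.

Lemma pl_measurable_le s e : measurable [set z | `|pl s z| <= e].
Proof.
apply: measurable_realfun.closed_measurable.
have -> : [set z | `|pl s z| <= e] = (fun z => `|pl s z|) @^-1` [set y | y <= e].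
  by [].
apply: preimage_closed; last exact: closed_le.
by move=> z _; apply: cvg_norm; exact: continuous_pl.
Qed.

(** The sum telescopes to the linear interpolation of w between the integers
    around y: ramps starting before the integer part K of y are saturated, those
    starting after it vanish, and the one at K is the fractional part.  So its
    value is a convex combination of [w K] and [w K.+1]. *)
Lemma interpolation_near (w : nat -> R) (N : nat) (y c e : R) :
  0 <= y < N%:R ->
  `|w (Num.truncn y) - c| <= e -> `|w (Num.truncn y).+1 - c| <= e ->
  `|w 0%N + \sum_(0 <= k < N) (w k.+1 - w k) * ramp (y - k%:R) - c| <= e.
Proof.
move=> /andP[y0 yN]; have /andP[] := truncn_itv y0.
set K := Num.truncn y => Ky yK wK wK1.
have KN : (K < N)%N by rewrite -(ltr_nat R); apply: le_lt_trans yN.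
rewrite (@big_cat_nat _ _ _ K) //=; last exact: ltnW.
rewrite (@telescope_sumr_eq _ _ _ w); last 2 first.
- by [].
- move=> k /andP[_ kK]; rewrite ramp_ge1 ?mulr1 // lerBrDr nat1r.
  by apply: le_trans Ky; rewrite ler_nat.
rewrite big_ltn // big_nat_cond big1 => [|k /andP[/andP[Kk _] _]]; last first.
  by rewrite ramp_le0 ?mulr0 // subr_le0; apply: ltW (lt_le_trans yK _); rewrite ler_nat.
rewrite addr0 ramp_itv; last by rewrite subr_ge0 Ky lerBlDr nat1r ltW.
set t := y - K%:R.
have t0 : 0 <= t by rewrite subr_ge0.
have t1 : 0 <= 1 - t by rewrite subr_ge0 lerBlDr nat1r ltW.
have -> : w 0%N + (w K - w 0%N + (w K.+1 - w K) * t) - c =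
    (1 - t) * (w K - c) + t * (w K.+1 - c) by ring.
apply: le_trans (ler_normD _ _) _; rewrite !normrM (ger0_norm t0) (ger0_norm t1).
have -> : e = (1 - t) * e + t * e by ring.
by apply: lerD; apply: ler_wpM2l.
Qed.

Lemma pl_interpolation (v : nat -> rat) (m a : rat) (N : nat) :
  exists s, forall z, pl s z = ratr (v 0%N) +
    \sum_(0 <= k < N) (ratr (v k.+1) - ratr (v k)) * ramp (ratr m * z + ratr a - k%:R).
Proof.
(* the first triple is the constant v 0, the value of ramp at 1 being 1 *)
exists ((v 0%N, 0, -1) :: [seq (v k.+1 - v k, m, k%:R - a) | k <- index_iota 0 N]).
move=> z; rewrite pl_cons ramp_ge1; last by rewrite rmorph0 rmorphN1; lra.
rewrite mulr1 /pl big_map; congr (_ + _); apply: eq_bigr => k _ /=.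
by rewrite !rmorphB /= ratr_nat; congr (_ * ramp _); ring.
Qed.

Lemma rat_near (c e : R) : 0 < e -> exists q : rat, `|ratr q - c| < e.
Proof.
move=> e0; have [|q] := @rat_in_itvoo R (c - e) (c + e); first lra.
by rewrite in_itv /= -ltr_distl => ?; exists q.
Qed.

(** With M = n+1, interpolate on the grid of mesh 1/M in [-M, M], giving to each
    node a rational value close to that of f at some point of X within 1/M of the
    node, if there is one.  For x in X both nodes around x have such a point,
    namely x itself, so the values used near x are values of f at points of X
    within 2/M of x, up to 1/M. *)
Lemma continuous_lim_pl (X : set R) (f : set_type X -> R) : continuous f ->
  exists s : nat -> seq (rat * rat * rat),
    forall x, (fun n => pl (s n) (set_val x)) @ \oo --> f x.
Proof.
move=> fc.
pose M n : R := n.+1%:R.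
have M0 n : 0 < M n by rewrite ltr0n.
have /choice [s sP] : forall n, exists s : seq (rat * rat * rat),
    forall (x : set_type X) (c e : R), `|set_val x| < M n ->
    (forall p : set_type X, M n * `|set_val p - set_val x| <= 2 -> `|f p - c| <= e) ->
    `|pl s (set_val x) - c| <= e + (M n)^-1.
  move=> n.
  (* node k is the point z with M z + M ^ 2 = k *)
  have /choice [v vP] : forall k : nat, exists q : rat,
      (exists p : set_type X, `|M n * set_val p + M n ^+ 2 - k%:R| <= 1) ->
      exists p : set_type X, `|M n * set_val p + M n ^+ 2 - k%:R| <= 1 /\
        `|ratr q - f p| < (M n)^-1.
    move=> k.
    have [[p pk]|np] := pselect (exists p : set_type X,
        `|M n * set_val p + M n ^+ 2 - k%:R| <= 1); last by exists 0.
    by have [|q qP] := @rat_near (f p) (M n)^-1; [rewrite invr_gt0|exists q => _; exists p].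
  have [s sE] := @pl_interpolation v n.+1%:R (n.+1%:R ^+ 2) (2 * n.+1 ^ 2).
  exists s => x c e xM xc.
  rewrite sE rmorphXn /= !ratr_nat -/(M n).
  set y := _ * _ + _.
  have [y0 yN] : 0 <= y /\ y < (2 * n.+1 ^ 2)%:R.
    move: xM; rewrite ltr_norml natrM natrX -/(M n) /y => /andP[].
    by have := M0 n; split; nra.
  have /andP[Ky yK] := truncn_itv y0.
  have near k : `|y - k%:R| <= 1 -> `|ratr (v k) - c| <= e + (M n)^-1.
    move=> yk; have [|p [pk qp]] := vP k; first by exists x.
    have -> : ratr (v k) - c = (f p - c) + (ratr (v k) - f p) by ring.
    apply: le_trans (ler_normD _ _) _; apply: lerD; last exact: ltW.
    apply: xc; rewrite -[X in X * _]gtr0_norm // -normrM.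
    have -> : M n * (set_val p - set_val x) =
      (M n * set_val p + M n ^+ 2 - k%:R) - (y - k%:R) by rewrite /y; ring.
    by apply: le_trans (ler_normB _ _) _; lra.
  apply: (@interpolation_near (fun k => ratr (v k))).
  - by rewrite y0 yN.
  - by apply: near; rewrite ger0_norm; move: yK; rewrite -natr1; lra.
  - by apply: near; rewrite ler0_norm; move: yK; rewrite -natr1; lra.
exists s => x; apply/cvgrPdist_le => e e0.
have [W [oW Wx WU]] : exists W : set R, [/\ open W, W (set_val x) &
    forall p : set_type X, W (set_val p) -> `|f p - f x| < e / 2].
  have : nbhs x [set p | `|f p - f x| < e / 2].
    have /cvgrPdist_lt/(_ (e / 2)) := fc x.
    by rewrite divr_gt0 // => /(_ isT); apply: filterS => p /=; rewrite distrC.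
  by move=> [_ /= [[W oW <-] /= Wx WU]]; exists W; split => // p Wp; exact: WU.
have /nbhs_ballP[d /= d0 dW] : nbhs (set_val x) W by exact: open_nbhs_nbhs.
near=> n.
have nx : `|set_val x| < M n.
  apply: (@lt_trans _ _ n%:R); last by rewrite ltr_nat.
  by near: n; exact: nbhs_infty_gtr.
have nd : 2 / d < M n.
  apply: (@lt_trans _ _ n%:R); last by rewrite ltr_nat.
  by near: n; exact: nbhs_infty_gtr.
have ne : 2 / e < M n.
  apply: (@lt_trans _ _ n%:R); last by rewrite ltr_nat.
  by near: n; exact: nbhs_infty_gtr.
rewrite distrC; apply: (@le_trans _ _ (e / 2 + (M n)^-1)).
  apply: sP => // p pn; apply/ltW/WU/dW; rewrite /ball /= distrC.
  rewrite -(ltr_pM2l (M0 n)); apply: le_lt_trans pn _.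
  by rewrite -ltr_pdivrMr.
rewrite [X in _ <= X](splitr e) lerD2l.
by rewrite invf_ple ?posrE ?divr_gt0 // invf_div ltW //.
Unshelve. all: by end_near. Qed.

(** The two new terms make a trapezoid of height c, the difference of the ramps
    at m (z - q) + 2 and m (z - q) - 1: it is flat within 1/m of q and vanishes
    beyond 2/m. *)
Lemma pl_bump (c m q : rat) (s : seq (rat * rat * rat)) :
  let s' := (c, m, m * q - 2) :: (- c, m, m * q + 1) :: s in
  (forall z, `|ratr m * (z - ratr q)| <= 1 -> pl s' z = ratr c + pl s z) /\
  (forall z, 2 <= `|ratr m * (z - ratr q)| -> pl s' z = pl s z).
Proof.
move=> s'; have s'E z : pl s' z = ratr c * (ramp (ratr m * (z - ratr q) + 2) -
    ramp (ratr m * (z - ratr q) - 1)) + pl s z.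
  rewrite !pl_cons rmorphB [ratr (m * q + 1)]rmorphD !rmorphM rmorphN /= !rmorph_nat.
  rewrite (_ : ratr m * z - _ = ratr m * (z - ratr q) + 2); last by ring.
  rewrite (_ : ratr m * z - _ = ratr m * (z - ratr q) - 1); last by ring.
  by ring.
split=> z; rewrite s'E; set t := ratr m * _.
  by rewrite ler_norml => /andP[? ?]; rewrite ramp_ge1 ?ramp_le0; [ring|lra|lra].
rewrite ler_normr => /orP[?|?].
  by rewrite !ramp_ge1; [ring|lra|lra].
by rewrite !ramp_le0; [ring|lra|lra].
Qed.

(** Induction on F: a new point x0 gets a bump correcting the value there, so
    narrow that it misses the points already treated and costs measure at most
    e/2.  The constant function 1 starts the induction. *)
Lemma pl_dense (F : seq R) (y : R -> R) (d e : R) : 0 < d -> 0 < e ->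
  exists s, (forall x, x \in F -> `|pl s x - y x| < d) /\
    exists B : set R, [/\ measurable B, (mu B <= e%:E)%E &
      forall z, ~ B z -> pl s z = 1].
Proof.
move=> d0; elim: F e => [|x0 F IH] e e0.
  exists [:: (1, 0, -1)]; split => //; exists set0; split => //.
    by rewrite measure0 lee_fin ltW.
  move=> z _; rewrite pl_cons /pl big_nil ramp_ge1 ?rmorph1; first by ring.
  by rewrite rmorph0 rmorphN1; lra.
have [|s [sF [B [mB muB sB]]]] := IH (e / 2); first by rewrite divr_gt0.
have [x0F|x0F] := boolP (x0 \in F).
  exists s; split; first by move=> x; rewrite inE => /predU1P[->|]; exact: sF.
  by exists B; split => //; apply: le_trans muB _; rewrite lee_fin; lra.
(* the bump has a rational centre q within 1/m of x0 and support of radius 2/m,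
   hence the distance 3/m from x0 and the measure 4/m <= e/2 *)
have [m [m0 me mF]] : exists m : nat, [/\ (0 < m)%N, 8 / e <= m%:R &
    forall x, x \in F -> 3 <= m%:R * `|x - x0|].
  have : \forall m \near \oo, forall x, x \in F -> 3 <= m%:R * `|x - x0|.
    elim: F x0F {IH sF} => [|x F IH]; first by move=> _; exact: nearW.
    rewrite inE negb_or => /andP[xx0 /IH {}IH].
    have xp : 0 < `|x - x0| by rewrite normr_gt0 subr_eq0 eq_sym.
    near=> m => z; rewrite inE => /predU1P[->|].
      by rewrite -ler_pdivrMr //; near: m; exact: nbhs_infty_ger.
    by move: z; near: m; exact: IH.
  move=> mF; near \oo => m; exists m; split.
  - by near: m; exact: nbhs_infty_gt.
  - by near: m; exact: nbhs_infty_ger.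
  - by near: m.
have mp : 0 < m%:R :> R by rewrite ltr0n.
have [|q qx0] := @rat_near x0 m%:R^-1; first by rewrite invr_gt0.
have mq : `|m%:R * (x0 - ratr q)| <= 1.
  by rewrite normrM gtr0_norm // distrC mulrC -ler_pdivlMr // mul1r ltW.
have [c cP] := @rat_near (y x0 - pl s x0) d d0.
have [bump1 bump0] := pl_bump c m%:R q s.
exists ((c, m%:R, m%:R * q - 2) :: (- c, m%:R, m%:R * q + 1) :: s); split.
  move=> x; rewrite inE => /predU1P[->|xF].
    rewrite bump1 ?ratr_nat //.
    by have -> : ratr c + pl s x0 - y x0 = ratr c - (y x0 - pl s x0) by ring.
  rewrite bump0; first exact: sF.
  have := mF _ xF; rewrite ratr_nat -[X in X * _]gtr0_norm // -normrM.
  have -> : m%:R * (x - ratr q) = m%:R * (x - x0) + m%:R * (x0 - ratr q) by ring.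
  by have := ler_normD (m%:R * (x - x0) + m%:R * (x0 - ratr q)) (- (m%:R * (x0 - ratr q)));
     rewrite addrK normrN; lra.
exists (B `|` ball (ratr q : R) (2 / m%:R)); split.
- by apply: measurableU => //; exact: measurable_realfun.measurable_ball.
- have mb : measurable (ball (ratr q : R) (2 / m%:R)).
    exact: measurable_realfun.measurable_ball.
  apply: (@le_trans _ _ (mu B + mu (ball (ratr q : R) (2 / m%:R)))%E).
    exact: measureU2.
  rewrite [e in (_ <= e%:E)%E](_ : e = e / 2 + e / 2); last by field.
  rewrite EFinD; apply: leeD => //.
  rewrite lebesgue_measure_ball; last by rewrite divr_ge0.
  rewrite lee_fin; move: me; rewrite ler_pdivrMr // => me.
  have -> : 2 / m%:R *+ 2 = 4 / m%:R :> R by rewrite -mulr_natr; ring.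
  by rewrite ler_pdivrMr //; lra.
- move=> z /not_orP[nB nb]; rewrite bump0; first exact: sB.
  move/negP: nb; rewrite /ball /= -leNgt distrC => nb.
  by rewrite ratr_nat normrM gtr0_norm // mulrC -ler_pdivrMr.
Unshelve. all: by end_near. Qed.

End piecewise_linear.

(** * The space of Baire functions *)

Lemma exists_ord_zero : exists a : omega1, forall b, ~ ord_lt b (Some a).
Proof.
have [A oA] : omega1 !=set0.
  apply/set0P/eqP => o0; apply: omega1_uncountable; rewrite o0.
  exact: countable0.
have [a0 _] : exists a : omega1, True by exists (SigSub (mem_set oA)).
elim/(well_founded_ind omega1_lt_wf): a0 => a IH.
have [[b ba]|na] := pselect (exists b, omega1_lt b a); first exact: IH ba.
by exists a => -[b ba|//]; apply: na; exists b.
Qed.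

(** A continuous function is a Baire function as the limit of a constant sequence
    from the class of index 0. *)
Lemma continuous_baire {R : realType} (T : topologicalType) (f : T -> R) :
  continuous f -> baire_class None f.
Proof.
move=> fc; have [a a0] := exists_ord_zero.
apply: (@BaireLim _ _ None f (fun=> Some a) (fun=> f)) => //.
- by move=> _; exact: Baire0.
- by move=> x; exact: cvg_cst.
Qed.

Section baire_topology.
Context {R : realType} {T : topologicalType}.
Notation Z := (baire_functions R T).

Lemma baire_functions_cvgP (F : set_system Z) (z : Z) : Filter F ->
  F --> z <-> forall x, (fun g : Z => (set_val g : T -> R) x) @ F --> (set_val z : T -> R) x.
Proof.
move=> FF.
have FFv : Filter ((set_val : Z -> {ptws T -> R}) @ F) by exact: fmap_filter.
have E := @pointwise_cvgP T R _ (set_val z : T -> R) FFv.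
split.
  move=> Fz; apply/E.
  by move=> A /(@initial_continuous Z {ptws T -> R} set_val) /Fz.
move=> /E Fz A [_ [[W oW <-] Wz sWA]].
rewrite nbhs_filterE; apply: filterS sWA _.
by apply: Fz; exact: open_nbhs_nbhs.
Qed.

End baire_topology.

(** * Sequential separability *)

Section subset_of_reals.
Context {R : realType} (X : set R).
Notation Z := (baire_functions R (set_type X)).
Notation mu := (@lebesgue_measure R).

Lemma pl_baire s : baire_class None (fun x : set_type X => pl s (set_val x) : R).
Proof.
apply: continuous_baire => x; apply: continuous_comp; last exact: continuous_pl.
exact: initial_continuous.
Qed.

Definition plX s : Z := SigSub (mem_set (pl_baire s)).

Lemma plXE s x : (set_val (plX s) : set_type X -> R) x = pl s (set_val x).
Proof. by []. Qed.

Definition pl_limit (f : set_type X -> R) :=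
  exists s : nat -> seq (rat * rat * rat),
    forall x, (fun n => pl (s n) (set_val x)) @ \oo --> f x.

(** For [u n] the limit of [pl (s n m)] in m, choose [g n] so that each x in X is,
    for almost all n, in the closed set where the tail of [pl (s n m)] from
    [m = g n] on oscillates by at most 1/(n+1); then [pl (s n (g n))] is within
    1/(n+1) of [u n] at x.  Oscillation replaces the distance to [u n] because
    the sets must be measurable on the whole line, where [u n] is not defined. *)
Lemma pl_limit_closed (u : nat -> set_type X -> R) (f : set_type X -> R) :
  sierpinski_set bounding_number X -> (forall n, pl_limit (u n)) ->
  (forall x, (fun n => u n x) @ \oo --> f x) -> pl_limit f.
Proof.
move=> bX /choice [s su] uf.
pose A n m : set R := \bigcap_(i in [set i | (m <= i)%N])
  \bigcap_(j in [set j | (m <= j)%N])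
    [set z | `|pl (s n i) z - pl (s n j) z| <= n.+1%:R^-1].
have mA n m : measurable (A n m).
  apply: bigcap_measurableType => i _; apply: bigcap_measurableType => j _.
  apply: measurable_realfun.closed_measurable.
  rewrite (_ : [set z | _] =
    (fun z => `|pl (s n i) z - pl (s n j) z|) @^-1` [set y | y <= n.+1%:R^-1]) //.
  apply: preimage_closed; last exact: closed_le.
  by move=> z _; apply: cvg_norm; apply: cvgB; exact: continuous_pl.
have incA n : {homo A n : m p / (m <= p)%N >-> m `<=` p}.
  move=> m p mp z Az i /= pi j /= pj.
  by apply: Az => /=; exact: leq_trans mp _.
have XA n : X `<=` \bigcup_m A n m.
  move=> z Xz; pose x : set_type X := SigSub (mem_set Xz).
  have /cvgrPdist_le/(_ (n.+1%:R^-1 / 2)) := su n x.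
  rewrite divr_gt0 // ?invr_gt0 // => /(_ isT) [m _ mP].
  exists m => // i mi j mj /=.
  have := mP i mi; have := mP j mj; rewrite /= (erefl : set_val x = z) => h1 h2.
  rewrite (_ : _ - _ = (u n x - pl (s n j) z) - (u n x - pl (s n i) z)); last by ring.
  rewrite [leRHS]splitr; apply: le_trans (ler_normB _ _) _; exact: lerD.
have [g gP] := sierpinski_eventually bX mA incA XA.
exists (fun n => s n (g n)) => x.
have near_u : \forall n \near \oo, `|u n x - pl (s n (g n)) (set_val x)| <= n.+1%:R^-1.
  have := gP (set_val x) (set_valP x); apply: filterS => n An.
  have cv : (fun i => `|pl (s n i) (set_val x) - pl (s n (g n)) (set_val x)|) @ \oo
      --> `|u n x - pl (s n (g n)) (set_val x)|.
    by apply: cvg_norm; apply: cvgB; [exact: su|exact: cvg_cst].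
  apply: (cvgr_to_le cv).
  near=> i; apply: An => //=.
  by near: i; exact: nbhs_infty_ge.
apply/cvgrPdist_le => e e0.
have /cvgrPdist_le/(_ (e / 2)) := uf x.
rewrite divr_gt0 // => /(_ isT) ue.
near=> n.
rewrite (_ : _ - _ = (f x - u n x) + (u n x - pl (s n (g n)) (set_val x))); last by ring.
rewrite [e]splitr; apply: le_trans (ler_normD _ _) _; apply: lerD.
  by near: n.
apply: (@le_trans _ _ n.+1%:R^-1); first by near: n.
rewrite invf_ple ?posrE ?divr_gt0 // invf_div.
apply: (@le_trans _ _ n%:R); last by rewrite ler_nat.
by near: n; exact: nbhs_infty_ger.
Unshelve. all: by end_near. Qed.

Lemma baire_pl_limit alpha (f : set_type X -> R) :
  sierpinski_set bounding_number X -> baire_class alpha f -> pl_limit f.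
Proof.
move=> bX; elim => [_ {}f _ fc|_ {}f beta u _ _ IH uf].
  exact: continuous_lim_pl.
exact: pl_limit_closed uf.
Qed.

Lemma sequentially_separable_baire :
  sierpinski_set bounding_number X -> sequentially_separable Z.
Proof.
move=> bX; exists (range plX); split.
  by apply: (card_le_trans (card_image_le _ _)); exact: countableP.
move=> z; have [s sz] := baire_pl_limit bX (set_valP z).
exists (fun n => plX (s n)); split; first by move=> n; exists (s n).
by apply/baire_functions_cvgP => x; exact: sz.
Qed.

(** * Failure of strong sequential separability *)

Definition near_zero (s : seq (rat * rat * rat)) : set R :=
  [set z | `|pl s z| <= 2^-1].

(** By [pl_dense], any z is the limit along the filter generated by the sets [B]
    of members of D that are close to z on a finite set, so every neighbourhood
    of z contains one. *)
Lemma dense_pl_small (e : R) : 0 < e ->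
  dense (plX @` [set s |
    (mu (near_zero s) <= e%:E)%E]).
Proof.
move=> e0 O [z Oz] oO.
set D := plX @` _.
(* pl_dense wants targets on the whole line: extend z from X *)
have /choice [y yP] : forall r : R, exists v : R,
    forall x : set_type X, set_val x = r -> (set_val z : set_type X -> R) x = v.
  move=> r; have [Xr|nX] := pselect (X r); last first.
    by exists 0 => x xr; case: nX; rewrite -xr; exact: set_valP.
  exists ((set_val z : set_type X -> R) (SigSub (mem_set Xr))) => x xr.
  by congr (_ _); apply: val_inj.
pose B (p : seq R * R) : set Z := [set g | D g /\ forall x : set_type X,
  set_val x \in p.1 -> `|(set_val z : set_type X -> R) x - (set_val g : set_type X -> R) x| < p.2].
pose F := filter_from [set p : seq R * R | 0 < p.2] B.
have FF : ProperFilter F.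
  apply: filter_from_proper.
    apply: filter_from_filter; first by exists ([::], 1) => /=.
    move=> [l d] [l' d'] /= d0 d'0; exists (l ++ l', Num.min d d').
      by rewrite /= lt_min d0.
    move=> g [Dg gP]; split; split => // x /= xl.
      by have := gP x; rewrite /= mem_cat xl lt_min => /(_ isT) /andP[].
    by have := gP x; rewrite /= mem_cat xl orbT lt_min => /(_ isT) /andP[].
  move=> [l d] /= d0; have [s [sl [C [mC muC sC]]]] := pl_dense l y d0 e0.
  exists (plX s); split.
    exists s => //=; apply: le_trans muC; apply: lebesgue_measure_le => //.
      exact: pl_measurable_le.
    by move=> t st; apply: contrapT => /sC ts; move: st; rewrite /near_zero /= ts normr1; lra.
  by move=> x /= /sl; rewrite plXE distrC (yP _ x erefl).
have Fz : F --> z.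
  apply/baire_functions_cvgP => x; apply/cvgrPdist_lt => d d0.
  exists ([:: set_val x], d) => // g [_ /= gP]; apply: gP.
  by rewrite inE.
have [p p0 pO] : F O by apply: Fz; exact: open_nbhs_nbhs.
have [g Bg] : B p !=set0 by apply: (@filter_ex _ _ FF); exists p.
by exists g; split; [exact: pO|case: Bg].
Qed.

Lemma not_strongly_sequentially_separable_baire :
  sierpinski_set bounding_number X -> ~ strongly_sequentially_separable Z.
Proof.
move=> bX [_ sep]; apply: (sierpinski_not_negligible bX).
apply: negligible_of_small_covers => e e0.
(* plX [::] is the zero function *)
have [|u [uD u0]] := sep _ _ (dense_pl_small e0) (plX [::]).
  by apply: (card_le_trans (card_image_le _ _)); exact: countableP.
have /choice [s sP] : forall n, exists s,
    (mu (near_zero s) <= e%:E)%E /\ plX s = u n.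
  by move=> n; have [s ? ?] := uD n; exists s.
have [mL muL] := @measure_liminf_le R (fun n => near_zero (s n))
  e%:E (fun n => pl_measurable_le _ _) (fun n => (sP n).1).
eexists; split; [exact: mL| |exact: muL].
move=> r Xr; pose x : set_type X := SigSub (mem_set Xr).
move: u0 => /baire_functions_cvgP /(_ x) /cvgrPdist_le /(_ 2^-1).
rewrite invr_gt0 ltr0n => /(_ isT) [n _ nP]; exists n => // i /= ni.
by have := nP i ni; rewrite /= -(sP i).2 !plXE /pl big_nil sub0r normrN.
Qed.

End subset_of_reals.

Theorem proposition4p29 (R : realType) (X : set R) :
  sierpinski_set bounding_number X ->
  sequentially_separable (baire_functions R (set_type X)) /\
  ~ strongly_sequentially_separable (baire_functions R (set_type X)).
Proof.
move=> bX; split; first exact: sequentially_separable_baire.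
exact: not_strongly_sequentially_separable_baire.
Qed.
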